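(* Let $0<\beta\le 1/2$, $0<p<1$, $q=1-p$, with $(\beta,p)\neq(1/2,1/2)$. There exists a unique distribution function $F_{\beta,p}$ on $\mathbb{R}$ satisfying the functional equation $$F(x)=pF(x/\beta)+qF(x/\beta+1-1/\beta)\quad\text{for all }x\in\mathbb{R},$$ and it is given by $$F_{\beta,p}(x)=\begin{cases}0&\text{if }x\le0,\\ x^{\log p/\log\beta}\,\nu_{\beta,p}(\log x)&\text{if }0<x\le1,\\ 1&\text{if }x>1,\end{cases}$$ where $\nu_{\beta,p}:\mathbb{R}\to\mathbb{R}$ is positive, bounded, and has period $|\log\beta|$. In addition, the following properties hold: (i) $F_{\beta,p}(\beta x)=pF_{\beta,p}(x)$ for $0<x<1$; (ii) $1-F_{\beta,p}(1-x)=F_{\beta,q}(x)$ for all $x\in\mathbb{R}$; (iii) $1-F_{\beta,p}$ is not regularly varying at $x=1$.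
   Context: A distribution function on $\mathbb{R}$ is a nondecreasing right-continuous function with limits $0$ at $-\infty$ and $1$ at $+\infty$. $F_{\beta,q}$ denotes the distribution function obtained by interchanging the roles of $p$ and $q$, i.e. the unique distribution function satisfying $F(x)=qF(x/\beta)+pF(x/\beta+1-1/\beta)$ for all $x\in\mathbb{R}$. The function $1-F$ is called regularly varying at $x=1$ (the right endpoint) if there is $\alpha\in\mathbb{R}$ such that $\lim_{h\downarrow0}\frac{1-F(1-xh)}{1-F(1-h)}=x^\alpha$ for all $x>0$. *)

(* Defs.v *)
From Stdlib Require Import Reals.
From Coquelicot Require Import Coquelicot.
Open Scope R_scope.

(* Stdlib's [increasing] is the non-strict notion. *)
Definition distribution_function (F : R -> R) : Prop :=
  increasing F /\
  (forall x, filterlim F (at_right x) (locally (F x))) /\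
  is_lim F m_infty 0 /\
  is_lim F p_infty 1.

Definition functional_equation (beta p q : R) (F : R -> R) : Prop :=
  forall x : R, F x = p * F (x / beta) + q * F (x / beta + 1 - 1 / beta).

Definition self_similar_df (beta p q : R) (F : R -> R) : Prop :=
  distribution_function F /\ functional_equation beta p q F.

(* Meant for [G] positive to the left of [1]: Stdlib's division is total.
   [at_right 0] ranges over [h > 0], and [Rpower x alpha] is only used at
   [x > 0], where it is the usual real power. *)
Definition regularly_varying_at_1 (G : R -> R) : Prop :=
  exists alpha : R, forall x : R, 0 < x ->
    filterlim (fun h : R => G (1 - x * h) / G (1 - h))
      (at_right 0) (locally (Rpower x alpha)).

(* Main.v *)
Require Import Defs.
From Stdlib Require Import Reals ZArith Lra Lia FunctionalExtensionality.
From Coquelicot Require Import Coquelicot.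
Open Scope R_scope.

(** Since [beta <= 1 / 2], the right-hand side of the functional equation is a
    contraction, of factor [max p q] in the sup norm, on the nondecreasing
    functions equal to [0] on [(-oo, 0]] and to [1] on [[1, +oo)]. Every
    distribution function solving the equation is of this kind, which gives
    uniqueness; the iterates of a continuous function converge uniformly, so the
    solution is continuous and its reflection [1 - F (1 - x)] is again a
    (right-continuous) solution, with [p] and [q] interchanged.
    Regular variation of [1 - F] at [1] together with exact scaling by [beta]
    would force this reflection to be a pure power on [(0, 1]], which is
    incompatible with the functional equation unless [beta = p = 1 / 2]. *)

(** * The contraction and uniqueness of its fixed point *)

Definition self_similar_step (beta p q : R) (F : R -> R) (x : R) : R :=
  p * F (x / beta) + q * F (x / beta + 1 - 1 / beta).

Definition unit_interval_df (F : R -> R) : Prop :=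
  increasing F /\ (forall x, x <= 0 -> F x = 0) /\ (forall x, 1 <= x -> F x = 1).

Lemma div_nonpos (b x : R) : 0 < b -> x <= 0 -> x / b <= 0.
Proof. intros hb hx. apply Rle_div_l; lra. Qed.

Lemma div_ge_1 (b x : R) : 0 < b -> b <= x -> 1 <= x / b.
Proof. intros hb hx. apply Rle_div_r; lra. Qed.

(** Exhibits the right branch as the left branch conjugated by [x -> 1 - x], so that bounds on it
    follow from bounds on [(1 - x) / b]. *)
Lemma right_branch_eq (b x : R) : 0 < b -> x / b + 1 - 1 / b = 1 - (1 - x) / b.
Proof. intros hb. field. lra. Qed.

Lemma right_branch_nonpos (b x : R) :
  0 < b -> x <= 1 - b -> x / b + 1 - 1 / b <= 0.
Proof.
  intros hb hx. rewrite right_branch_eq by assumption.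
  assert (1 <= (1 - x) / b) by (apply div_ge_1; lra). lra.
Qed.

Lemma right_branch_ge_1 (b x : R) :
  0 < b -> 1 <= x -> 1 <= x / b + 1 - 1 / b.
Proof.
  intros hb hx. rewrite right_branch_eq by assumption.
  assert ((1 - x) / b <= 0) by (apply div_nonpos; lra). lra.
Qed.

Lemma unit_interval_df_range (F : R -> R) (x : R) :
  unit_interval_df F -> 0 <= F x <= 1.
Proof.
  intros (hi & h0 & h1). split.
  - rewrite <- (h0 (Rmin x 0)) by apply Rmin_r. apply hi, Rmin_l.
  - rewrite <- (h1 (Rmax x 1)) by apply Rmax_r. apply hi, Rmax_l.
Qed.

Lemma step_unit_interval_df (b p q : R) (F : R -> R) :
  0 < b <= 1 / 2 -> 0 < p < 1 -> q = 1 - p ->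
  unit_interval_df F -> unit_interval_df (self_similar_step b p q F).
Proof.
  intros hb hp hq (hi & h0 & h1). unfold self_similar_step.
  split; [|split].
  - intros x y hxy.
    assert (h : x / b <= y / b).
    { apply Rmult_le_compat_r; [|assumption].
      apply Rlt_le, Rinv_0_lt_compat; lra. }
    apply Rplus_le_compat; (apply Rmult_le_compat_l; [lra|]); apply hi; lra.
  - intros x hx. rewrite !h0; [ring| |].
    + apply right_branch_nonpos; lra.
    + apply div_nonpos; lra.
  - intros x hx. rewrite !h1; [lra| |].
    + apply right_branch_ge_1; lra.
    + apply div_ge_1; lra.
Qed.

(* As [b <= 1 / 2], at every [x] at most one of the two branches lands inside
   [(0, 1)], so only one of the two terms survives. *)
Lemma step_contraction (b p q C : R) (D : R -> R) :
  0 < b <= 1 / 2 -> 0 <= p -> 0 <= q ->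
  (forall x, x <= 0 -> D x = 0) -> (forall x, 1 <= x -> D x = 0) ->
  (forall x, Rabs (D x) <= C) ->
  forall x, Rabs (self_similar_step b p q D x) <= Rmax p q * C.
Proof.
  intros hb hp hq h0 h1 hC x. unfold self_similar_step.
  destruct (Rle_dec x (1 - b)) as [hx|hx].
  - rewrite (h0 (x / b + 1 - 1 / b)) by (apply right_branch_nonpos; lra).
    rewrite Rmult_0_r, Rplus_0_r, Rabs_mult, (Rabs_pos_eq p) by assumption.
    apply Rmult_le_compat; auto using Rabs_pos, Rmax_l.
  - rewrite (h1 (x / b)) by (apply div_ge_1; lra).
    rewrite Rmult_0_r, Rplus_0_l, Rabs_mult, (Rabs_pos_eq q) by assumption.
    apply Rmult_le_compat; auto using Rabs_pos, Rmax_r.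
Qed.

Lemma iter_step_unit_interval_df (b p q : R) (F : R -> R) (n : nat) :
  0 < b <= 1 / 2 -> 0 < p < 1 -> q = 1 - p ->
  unit_interval_df F ->
  unit_interval_df (Nat.iter n (self_similar_step b p q) F).
Proof.
  intros hb hp hq hF. induction n as [|n IH]; [assumption|].
  now apply step_unit_interval_df.
Qed.

(** Induction on [n]: the step is linear, so the difference of two iterates is the step applied to
    the previous difference, which vanishes outside [(0, 1)]. The initial bound 1 holds because both
    functions take values in [[0, 1]]. *)
Lemma iter_step_close (b p q : R) (F G : R -> R) (n : nat) :
  0 < b <= 1 / 2 -> 0 < p < 1 -> q = 1 - p ->
  unit_interval_df F -> unit_interval_df G ->
  forall x, Rabs (Nat.iter n (self_similar_step b p q) F x -
                  Nat.iter n (self_similar_step b p q) G x) <= Rmax p q ^ n.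
Proof.
  intros hb hp hq hF hG. induction n as [|n IH]; intros x.
  - simpl. pose proof (unit_interval_df_range F x hF).
    pose proof (unit_interval_df_range G x hG). apply Rabs_le; lra.
  - destruct (iter_step_unit_interval_df b p q F n hb hp hq hF) as (_ & f0 & f1).
    destruct (iter_step_unit_interval_df b p q G n hb hp hq hG) as (_ & g0 & g1).
    simpl. set (Fn := Nat.iter n _ F) in *. set (Gn := Nat.iter n _ G) in *.
    replace (self_similar_step b p q Fn x - self_similar_step b p q Gn x)
      with (self_similar_step b p q (fun y => Fn y - Gn y) x)
      by (unfold self_similar_step; ring).
    apply step_contraction; try lra; try assumption.
    + intros y hy. rewrite f0, g0 by assumption. ring.
    + intros y hy. rewrite f1, g1 by assumption. ring.
Qed.

Lemma pow_Rmax_lim (p q : R) :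
  0 < p < 1 -> q = 1 - p -> is_lim_seq (fun n => Rmax p q ^ n) 0.
Proof.
  intros hp hq. apply is_lim_seq_geom.
  rewrite Rabs_pos_eq.
  - apply Rmax_lub_lt; lra.
  - apply Rle_trans with p; [lra|apply Rmax_l].
Qed.

Lemma pow_Rmax_small (p q eps : R) :
  0 < p < 1 -> q = 1 - p -> 0 < eps ->
  exists N, forall n, (N <= n)%nat -> Rmax p q ^ n < eps.
Proof.
  intros hp hq heps.
  pose proof (pow_Rmax_lim p q hp hq) as hlim. apply is_lim_seq_spec in hlim.
  destruct (hlim (mkposreal eps heps)) as [N hN].
  exists N. intros n hn. specialize (hN n hn). simpl in hN.
  apply Rabs_def2 in hN. lra.
Qed.

Lemma pow_Rmax_bound_eq (p q u v : R) :
  0 < p < 1 -> q = 1 - p ->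
  (forall n, Rabs (u - v) <= Rmax p q ^ n) -> u = v.
Proof.
  intros hp hq h.
  destruct (Req_dec u v) as [|hne]; [assumption|exfalso].
  assert (0 < Rabs (u - v)) by (apply Rabs_pos_lt; lra).
  destruct (pow_Rmax_small p q (Rabs (u - v))) as [N hN]; try assumption.
  specialize (hN N (le_n _)). specialize (h N). lra.
Qed.

Lemma fixed_point_unique (b p q : R) (F G : R -> R) :
  0 < b <= 1 / 2 -> 0 < p < 1 -> q = 1 - p ->
  unit_interval_df F -> unit_interval_df G ->
  functional_equation b p q F -> functional_equation b p q G -> F = G.
Proof.
  intros hb hp hq hF hG eF eG.
  assert (fix_iter : forall H n, functional_equation b p q H ->
            Nat.iter n (self_similar_step b p q) H = H).
  { intros H n eH. induction n as [|n IH]; [reflexivity|]. simpl.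
    rewrite IH. apply functional_extensionality. intros x. symmetry. apply eH. }
  apply functional_extensionality. intros x.
  apply (pow_Rmax_bound_eq p q); try assumption. intros n.
  pose proof (iter_step_close b p q F G n hb hp hq hF hG x) as h.
  now rewrite !fix_iter in h.
Qed.

(** * Boundary values of an arbitrary solution *)

(* For [x < 0] both branches lie to the left of [2 * x]. *)
Lemma self_similar_le_double (b p q : R) (F : R -> R) :
  0 < b <= 1 / 2 -> 0 < p < 1 -> q = 1 - p -> increasing F ->
  functional_equation b p q F ->
  forall x, x <= 0 -> F x <= F (2 * x).
Proof.
  intros hb hp hq hi e x hx. rewrite (e x).
  assert (hdiv : x / b <= 2 * x) by (apply Rle_div_l; nra).
  assert (hinv : 1 <= 1 / b) by (apply div_ge_1; lra).
  pose proof (hi (x / b) (2 * x) hdiv) as h1.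
  assert (h2 : F (x / b + 1 - 1 / b) <= F (2 * x)) by (apply hi; lra).
  nra.
Qed.

(** Iterating [F x <= F (2 * x)] pushes the argument to [m_infty], where [F] tends to 0; hence
    [F x <= 0]. Monotonicity gives [F (2 ^ n * x) <= F x], whose limit is the reverse inequality. *)
Lemma self_similar_neg (b p q : R) (F : R -> R) :
  0 < b <= 1 / 2 -> 0 < p < 1 -> q = 1 - p -> increasing F ->
  is_lim F m_infty 0 -> functional_equation b p q F ->
  forall x, x < 0 -> F x = 0.
Proof.
  intros hb hp hq hi hl e x hx.
  assert (hseq : is_lim_seq (fun n => F (2 ^ n * x)) 0).
  { apply is_lim_comp_seq with m_infty; [assumption|now exists 0%nat|].
    apply is_lim_seq_ext with (fun n => x * 2 ^ n); [intros; ring|].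
    replace m_infty with (Rbar_mult x p_infty).
    - apply is_lim_seq_scal_l, is_lim_seq_geom_p. lra.
    - apply is_Rbar_mult_unique, is_Rbar_mult_sym, is_Rbar_mult_p_infty_neg.
      exact hx. }
  assert (hup : forall n, F x <= F (2 ^ n * x)).
  { induction n as [|n IH]; [rewrite Rmult_1_l; lra|].
    apply Rle_trans with (1 := IH). simpl. rewrite Rmult_assoc.
    apply (self_similar_le_double b p q); try assumption.
    pose proof (pow_lt 2 n). nra. }
  apply Rle_antisym.
  - change (Rbar_le (F x) 0).
    apply (is_lim_seq_le (fun _ => F x) _ _ _ hup); [apply is_lim_seq_const|assumption].
  - change (Rbar_le 0 (F x)).
    apply (is_lim_seq_le (fun n => F (2 ^ n * x)) (fun _ => F x));
      [|assumption|apply is_lim_seq_const].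
    intros n. apply hi. pose proof (pow_R1_Rle 2 n). nra.
Qed.

(** The reflection [x -> 1 - x] carries each branch to the other, which exchanges the weights; the
    constant 1 is reproduced because [p + q = 1]. *)
Lemma functional_equation_reflect (b p q : R) (F : R -> R) :
  0 < b -> q = 1 - p -> functional_equation b p q F ->
  functional_equation b q p (fun x => 1 - F (1 - x)).
Proof.
  intros hb hq e x. rewrite (e (1 - x)).
  replace ((1 - x) / b + 1 - 1 / b) with (1 - x / b) by (field; lra).
  replace (1 - (x / b + 1 - 1 / b)) with ((1 - x) / b) by (field; lra).
  subst q. ring.
Qed.

Lemma increasing_reflect (F : R -> R) :
  increasing F -> increasing (fun x => 1 - F (1 - x)).
Proof.
  intros hi x y hxy. assert (F (1 - y) <= F (1 - x)) by (apply hi; lra). lra.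
Qed.

Lemma is_lim_reflect (F : R -> R) (a : Rbar) (l : R) :
  is_lim F (Rbar_minus 1 a) l -> (a = m_infty \/ a = p_infty) ->
  is_lim (fun x => 1 - F (1 - x)) a (1 - l).
Proof.
  intros hl ha.
  apply (is_lim_minus' (fun _ => 1) (fun x => F (1 - x)) a 1 l); [apply is_lim_const|].
  apply (is_lim_comp F (fun x => 1 - x) a l (Rbar_minus 1 a)); [assumption| |].
  - apply (is_lim_minus (fun _ => 1) (fun x => x) a 1 a).
    + apply is_lim_const.
    + apply is_lim_id.
    + now destruct ha; subst a.
  - destruct ha; subst a; exists 0; intros; discriminate.
Qed.

Lemma self_similar_unit_interval_df (b p q : R) (F : R -> R) :
  0 < b <= 1 / 2 -> 0 < p < 1 -> q = 1 - p ->
  self_similar_df b p q F -> unit_interval_df F.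
Proof.
  intros hb hp hq ((hi & _ & hm & hM) & e).
  assert (hneg : forall x, x < 0 -> F x = 0)
    by (apply (self_similar_neg b p q); assumption).
  (* The reflected function solves the equation with the weights exchanged, so it vanishes at the
     negative point [1 - x]. *)
  assert (hpos : forall x, 1 < x -> F x = 1).
  { intros x hx.
    assert (h : 1 - F (1 - (1 - x)) = 0).
    { apply (self_similar_neg b q p (fun y => 1 - F (1 - y))); try lra.
      - now apply increasing_reflect.
      - replace (Finite 0) with (Finite (1 - 1)) by (f_equal; ring).
        apply is_lim_reflect; auto.
      - apply functional_equation_reflect; try assumption; lra. }
    replace (1 - (1 - x)) with x in h by ring. lra. }
  assert (hinv : 2 <= 1 / b) by (apply Rle_div_r; lra).
  split; [assumption|split]; intros x hx.
  (* The left branch fixes 0 and the right one sends it to a negative point, so [F 0 = p * F 0] with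
     [p < 1]. Dually, at 1 the equation reads [F 1 = p + q * F 1]. *)
  - destruct (Req_dec x 0) as [->|]; [|apply hneg; lra].
    pose proof (e 0) as h. rewrite (hneg (0 / b + 1 - 1 / b)) in h.
    + replace (0 / b) with 0 in h by (field; lra). nra.
    + replace (0 / b) with 0 by (field; lra). lra.
  - destruct (Req_dec x 1) as [->|]; [|apply hpos; lra].
    pose proof (e 1) as h. rewrite (hpos (1 / b)) in h by lra.
    replace (1 / b + 1 - 1 / b) with 1 in h by ring. nra.
Qed.

Lemma self_similar_df_unique (b p q : R) (F G : R -> R) :
  0 < b <= 1 / 2 -> 0 < p < 1 -> q = 1 - p ->
  self_similar_df b p q F -> self_similar_df b p q G -> F = G.
Proof.
  intros hb hp hq hF hG. apply (fixed_point_unique b p q); try assumption.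
  - now apply (self_similar_unit_interval_df b p q).
  - now apply (self_similar_unit_interval_df b p q).
  - apply hF.
  - apply hG.
Qed.

(** * Existence of a continuous solution *)

Lemma self_similar_df_of_continuous (b p q : R) (F : R -> R) :
  unit_interval_df F -> (forall x, continuous F x) ->
  functional_equation b p q F -> self_similar_df b p q F.
Proof.
  intros (hi & h0 & h1) hc e. split; [|assumption].
  split; [assumption|split; [|split]].
  - intros x P hP. apply filter_le_within. now apply hc.
  - apply is_lim_ext_loc with (fun _ => 0); [|apply is_lim_const].
    exists 0. intros y hy. symmetry. apply h0. lra.
  - apply is_lim_ext_loc with (fun _ => 1); [|apply is_lim_const].
    exists 1. intros y hy. symmetry. apply h1. lra.
Qed.

(** The uniform distribution function on [[0, 1]], a continuous starting point for the iteration. *)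
Definition clamp (x : R) : R := Rmax 0 (Rmin x 1).

Lemma clamp_unit_interval_df : unit_interval_df clamp.
Proof.
  unfold clamp. split; [|split].
  - intros x y hxy. apply Rle_max_compat_l, Rle_min_compat_r, hxy.
  - intros x hx. rewrite Rmin_left, Rmax_left; lra.
  - intros x hx. rewrite Rmin_right, Rmax_right; lra.
Qed.

Lemma clamp_lipschitz (x y : R) : Rabs (clamp y - clamp x) <= Rabs (y - x).
Proof.
  unfold clamp, Rmax, Rmin. repeat destruct (Rle_dec _ _);
    unfold Rabs; repeat destruct (Rcase_abs _); lra.
Qed.

Lemma clamp_continuous (x : R) : continuous clamp x.
Proof.
  apply filterlim_locally. intros eps. exists eps. intros y hy.
  apply Rle_lt_trans with (2 := hy). apply clamp_lipschitz.
Qed.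

Lemma step_continuous (b p q : R) (F : R -> R) :
  (forall x, continuous F x) -> forall x, continuous (self_similar_step b p q F) x.
Proof.
  intros hF x. unfold self_similar_step.
  apply (continuous_plus (fun y => p * F (y / b)) (fun y => q * F (y / b + 1 - 1 / b))).
  - apply (continuous_scal_r p (fun y => F (y / b))).
    apply (continuous_comp (fun y => y / b) F); [|apply hF].
    apply (ex_derive_continuous (fun y => y / b)). auto_derive. exact I.
  - apply (continuous_scal_r q (fun y => F (y / b + 1 - 1 / b))).
    apply (continuous_comp (fun y => y / b + 1 - 1 / b) F); [|apply hF].
    apply (ex_derive_continuous (fun y => y / b + 1 - 1 / b)). auto_derive. exact I.
Qed.

(** For [b = 1 / 3] and [p = q = 1 / 2] this is the Cantor function. [Lim_seq] and [real] are total;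
    [cantor_df_lim] shows that the iterates really converge to this value. *)
Definition cantor_df (b p q : R) (x : R) : R :=
  real (Lim_seq (fun n => Nat.iter n (self_similar_step b p q) clamp x)).

(** The [m]-th iterate is the [n]-fold step of the [(m - n)]-th one, so both terms are [n]-fold
    steps of functions covered by [iter_step_close]. *)
Lemma iter_step_cauchy (b p q : R) (n m : nat) (x : R) :
  0 < b <= 1 / 2 -> 0 < p < 1 -> q = 1 - p -> (n <= m)%nat ->
  Rabs (Nat.iter m (self_similar_step b p q) clamp x -
        Nat.iter n (self_similar_step b p q) clamp x) <= Rmax p q ^ n.
Proof.
  intros hb hp hq hnm. replace m with (n + (m - n))%nat by lia.
  rewrite Nat.iter_add.
  apply iter_step_close; try assumption.
  - apply iter_step_unit_interval_df; try assumption. apply clamp_unit_interval_df.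
  - apply clamp_unit_interval_df.
Qed.

Lemma cantor_df_lim (b p q : R) (x : R) :
  0 < b <= 1 / 2 -> 0 < p < 1 -> q = 1 - p ->
  is_lim_seq (fun n => Nat.iter n (self_similar_step b p q) clamp x)
    (cantor_df b p q x).
Proof.
  intros hb hp hq. apply Lim_seq_correct', ex_lim_seq_cauchy_corr.
  intros eps.
  destruct (pow_Rmax_small p q eps hp hq (cond_pos eps)) as [N hN].
  exists N. intros n m hn hm.
  destruct (Nat.le_ge_cases n m) as [h|h].
  - rewrite Rabs_minus_sym. apply Rle_lt_trans with (2 := hN n hn).
    now apply iter_step_cauchy.
  - apply Rle_lt_trans with (2 := hN m hm). now apply iter_step_cauchy.
Qed.

(** Limit [m -> oo] in the Cauchy estimate. The bound does not depend on [x]: convergence is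
    uniform, and continuity passes to the limit. *)
Lemma cantor_df_approx (b p q : R) (n : nat) (x : R) :
  0 < b <= 1 / 2 -> 0 < p < 1 -> q = 1 - p ->
  Rabs (cantor_df b p q x - Nat.iter n (self_similar_step b p q) clamp x)
    <= Rmax p q ^ n.
Proof.
  intros hb hp hq.
  set (F := fun k => Nat.iter k (self_similar_step b p q) clamp).
  change (Rbar_le (Rabs (cantor_df b p q x - F n x)) (Rmax p q ^ n)).
  apply (is_lim_seq_le_loc (fun m => Rabs (F m x - F n x)) (fun _ => Rmax p q ^ n)).
  - exists n. intros m hm. now apply iter_step_cauchy.
  - apply (is_lim_seq_abs _ (Finite (cantor_df b p q x - F n x))).
    apply is_lim_seq_minus'; [now apply cantor_df_lim|apply is_lim_seq_const].
  - apply is_lim_seq_const.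
Qed.

Lemma cantor_df_unit_interval_df (b p q : R) :
  0 < b <= 1 / 2 -> 0 < p < 1 -> q = 1 - p ->
  unit_interval_df (cantor_df b p q).
Proof.
  intros hb hp hq.
  assert (hn : forall n,
    unit_interval_df (Nat.iter n (self_similar_step b p q) clamp)).
  { intros n. apply iter_step_unit_interval_df; try assumption.
    apply clamp_unit_interval_df. }
  split; [|split].
  - intros x y hxy.
    change (Rbar_le (cantor_df b p q x) (cantor_df b p q y)).
    refine (is_lim_seq_le _ _ _ _ _ (cantor_df_lim b p q x hb hp hq)
              (cantor_df_lim b p q y hb hp hq)).
    intros n. now apply (hn n).
  - intros x hx. unfold cantor_df.
    rewrite (Lim_seq_ext _ (fun _ => 0)); [now rewrite Lim_seq_const|].
    intros n. now apply (hn n).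
  - intros x hx. unfold cantor_df.
    rewrite (Lim_seq_ext _ (fun _ => 1)); [now rewrite Lim_seq_const|].
    intros n. now apply (hn n).
Qed.

Lemma cantor_df_continuous (b p q : R) (x : R) :
  0 < b <= 1 / 2 -> 0 < p < 1 -> q = 1 - p -> continuous (cantor_df b p q) x.
Proof.
  intros hb hp hq. apply filterlim_locally. intros eps.
  assert (heps : 0 < eps / 3) by (pose proof (cond_pos eps); lra).
  destruct (pow_Rmax_small p q (eps / 3) hp hq heps) as [N hN].
  specialize (hN N (le_n _)).
  assert (hc : continuous (Nat.iter N (self_similar_step b p q) clamp) x).
  { clear hN. revert x. induction N as [|N IH]; intros x.
    - apply clamp_continuous.
    - simpl. now apply step_continuous. }
  pose proof (proj1 (filterlim_locally _ _) hc (mkposreal _ heps)) as hloc.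
  apply filter_imp with (2 := hloc). intros y hy.
  change (Rabs (cantor_df b p q y - cantor_df b p q x) < eps).
  change (Rabs (Nat.iter N (self_similar_step b p q) clamp y -
                Nat.iter N (self_similar_step b p q) clamp x) < eps / 3) in hy.
  pose proof (cantor_df_approx b p q N x hb hp hq) as hx.
  pose proof (cantor_df_approx b p q N y hb hp hq) as hy'.
  apply Rabs_def2 in hy. apply Rabs_le_between in hx. apply Rabs_le_between in hy'.
  apply Rabs_def1; lra.
Qed.

Lemma cantor_df_equation (b p q : R) :
  0 < b <= 1 / 2 -> 0 < p < 1 -> q = 1 - p ->
  functional_equation b p q (cantor_df b p q).
Proof.
  intros hb hp hq x.
  pose proof (cantor_df_lim b p q x hb hp hq) as h.
  (* The shifted sequence has the same limit, and its terms are the step applied to the unshifted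
     ones; both sides are limits of one sequence. *)
  apply is_lim_seq_incr_1, is_lim_seq_unique in h.
  assert (h' : is_lim_seq
    (fun n => Nat.iter (S n) (self_similar_step b p q) clamp x)
    (p * cantor_df b p q (x / b) + q * cantor_df b p q (x / b + 1 - 1 / b))).
  { simpl. unfold self_similar_step at 1. apply is_lim_seq_plus'.
    - apply (is_lim_seq_scal_l _ p (cantor_df b p q (x / b))).
      now apply cantor_df_lim.
    - apply (is_lim_seq_scal_l _ q (cantor_df b p q (x / b + 1 - 1 / b))).
      now apply cantor_df_lim. }
  apply is_lim_seq_unique in h'. rewrite h' in h. now injection h.
Qed.

(** * The equation on each side of the gap *)

(** Since [b * x <= b <= 1 - b], the right branch sends [b * x] to a nonpositive point and
    contributes 0. *)
Lemma self_similar_left (b p q : R) (F : R -> R) :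
  0 < b <= 1 / 2 -> unit_interval_df F -> functional_equation b p q F ->
  forall x, x <= 1 -> F (b * x) = p * F x.
Proof.
  intros hb (_ & h0 & _) e x hx. rewrite e.
  rewrite (h0 (b * x / b + 1 - 1 / b)) by (apply right_branch_nonpos; nra).
  replace (b * x / b) with x by (field; lra). ring.
Qed.

Lemma self_similar_left_pow (b p q : R) (F : R -> R) (n : nat) :
  0 < b <= 1 / 2 -> unit_interval_df F -> functional_equation b p q F ->
  forall x, x <= 1 -> F (x * b ^ n) = p ^ n * F x.
Proof.
  intros hb hF e x hx. induction n as [|n IH]; simpl.
  - now rewrite Rmult_1_r, Rmult_1_l.
  - replace (x * (b * b ^ n)) with (b * (x * b ^ n)) by ring.
    rewrite (self_similar_left b p q F), IH; try assumption; [ring|].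
    assert (0 < b ^ n <= 1).
    { split; [apply pow_lt; lra|]. rewrite <- (pow1 n). apply pow_incr. lra. }
    nra.
Qed.

Lemma self_similar_above (b p q : R) (F : R -> R) :
  0 < b <= 1 / 2 -> unit_interval_df F -> functional_equation b p q F ->
  forall x, b <= x -> F x = p + q * F (x / b + 1 - 1 / b).
Proof.
  intros hb (_ & _ & h1) e x hx. rewrite e.
  rewrite (h1 (x / b)) by (apply div_ge_1; lra). ring.
Qed.

(** * The log-periodic factor *)

(** Evaluates [f] at the representative of [t] modulo [L] in [[- L, 0)]: [up r] is strictly above
    [r], by at most 1, so 0 is represented by [- L]. *)
Definition periodic_extension (L : R) (f : R -> R) (t : R) : R :=
  f (t - L * IZR (up (t / L))).

Lemma periodic_extension_arg_range (L t : R) :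
  0 < L -> - L <= t - L * IZR (up (t / L)) < 0.
Proof.
  intros hL. destruct (archimed (t / L)) as [h1 h2].
  assert (ht : t = L * (t / L)) by (field; lra).
  set (r := t / L) in *. rewrite ht. split; nra.
Qed.

Lemma periodic_extension_period (L : R) (f : R -> R) (t : R) :
  0 < L -> periodic_extension L f (t + L) = periodic_extension L f t.
Proof.
  intros hL. unfold periodic_extension. f_equal.
  replace ((t + L) / L) with (t / L + 1) by (field; lra).
  destruct (archimed (t / L)) as [h1 h2].
  rewrite <- (tech_up (t / L + 1) (up (t / L) + 1)); rewrite ?plus_IZR; lra.
Qed.

Lemma periodic_extension_eq (L : R) (f : R -> R) :
  0 < L -> (forall t, t <= 0 -> f (t - L) = f t) ->
  forall t, t <= 0 -> periodic_extension L f t = f t.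
Proof.
  intros hL hf t ht.
  assert (hn : forall (n : nat) s, s <= 0 -> f (s - L * INR n) = f s).
  { induction n as [|n IH]; intros s hs.
    - simpl. f_equal. ring.
    - rewrite S_INR, <- (IH s hs), <- (hf (s - L * INR n)).
      + f_equal. ring.
      + pose proof (pos_INR n). nra. }
  unfold periodic_extension.
  pose proof (periodic_extension_arg_range L t hL) as hr.
  set (k := up (t / L)) in *.
  destruct (Z.le_gt_cases 0 k) as [hk|hk].
  - rewrite <- (Z2Nat.id k hk), <- INR_IZR_INZ. now apply hn.
  - rewrite <- (hn (Z.to_nat (- k)) (t - L * IZR k)) by lra.
    rewrite INR_IZR_INZ, Z2Nat.id, opp_IZR by lia. f_equal. ring.
Qed.

(** Passing from [exp t] to [b * exp t] multiplies [F] by [p] and the power with exponent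
    [- (ln p / ln b)] by [1 / p]; the two factors cancel. *)
Lemma log_profile_shift (b p q : R) (F : R -> R) :
  0 < b <= 1 / 2 -> 0 < p -> unit_interval_df F -> functional_equation b p q F ->
  forall t, t <= 0 ->
  F (exp (t - - ln b)) * exp (- (ln p / ln b * (t - - ln b)))
  = F (exp t) * exp (- (ln p / ln b * t)).
Proof.
  intros hb hp hF e t ht.
  assert (hlnb : ln b < 0) by (rewrite <- ln_1; apply ln_increasing; lra).
  replace (t - - ln b) with (ln b + t) by ring.
  rewrite exp_plus, exp_ln by lra.
  rewrite (self_similar_left b p q F); try assumption.
  - replace (- (ln p / ln b * (ln b + t))) with (- ln p + - (ln p / ln b * t))
      by (field; lra).
    rewrite exp_plus, exp_Ropp, exp_ln by assumption. field. lra.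
  - rewrite <- exp_0. destruct (Req_dec t 0) as [->|]; [lra|].
    apply Rlt_le, exp_increasing. lra.
Qed.

Lemma self_similar_log_periodic (b p q : R) (F : R -> R) :
  0 < b <= 1 / 2 -> 0 < p < 1 -> unit_interval_df F ->
  functional_equation b p q F ->
  exists nu : R -> R,
    (forall t, 0 < nu t) /\
    (exists M, forall t, Rabs (nu t) <= M) /\
    (forall t, nu (t + Rabs (ln b)) = nu t) /\
    (forall x, 0 < x <= 1 -> F x = Rpower x (ln p / ln b) * nu (ln x)).
Proof.
  intros hb hp hF e.
  assert (hlnb : ln b < 0) by (rewrite <- ln_1; apply ln_increasing; lra).
  assert (hlnp : ln p < 0) by (rewrite <- ln_1; apply ln_increasing; lra).
  assert (hg : 0 < ln p / ln b).
  { replace (ln p / ln b) with (- ln p / - ln b) by (field; lra).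
    apply Rdiv_lt_0_compat; lra. }
  set (f := fun t => F (exp t) * exp (- (ln p / ln b * t))).
  assert (hL : 0 < - ln b) by lra.
  assert (hF1 : F b = p).
  { replace b with (b * 1) by ring. rewrite (self_similar_left b p q F hb hF e) by lra.
    destruct hF as (_ & _ & h1). rewrite h1; lra. }
  (* Only arguments in [[ln b, 0)] are read, where [F (exp s) >= F b = p]. *)
  assert (hpos : forall t, 0 < periodic_extension (- ln b) f t).
  { intros t. pose proof (periodic_extension_arg_range (- ln b) t hL) as hr.
    unfold periodic_extension, f. apply Rmult_lt_0_compat; [|apply exp_pos].
    apply Rlt_le_trans with (F b); [lra|]. apply hF.
    rewrite <- (exp_ln b) at 1 by lra.
    set (s := t - _) in *.
    destruct (Req_dec s (ln b)) as [->|]; [lra|]. apply Rlt_le, exp_increasing. lra. }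
  exists (periodic_extension (- ln b) f).
  split; [assumption|split; [|split]].
  (* The bound is [1 / p]: [F] is at most 1, and the exponential factor is largest at [s = ln b],
     where it equals [1 / p]. *)
  - exists (exp (- ln p)). intros t. rewrite Rabs_pos_eq by apply Rlt_le, hpos.
    pose proof (periodic_extension_arg_range (- ln b) t hL) as hr.
    unfold periodic_extension, f. set (s := t - _) in *.
    pose proof (unit_interval_df_range F (exp s) hF).
    rewrite <- (Rmult_1_l (exp (- ln p))).
    apply Rmult_le_compat; [lra|apply Rlt_le, exp_pos|lra|].
    assert (- (ln p / ln b * s) <= - ln p).
    { replace (ln p) with (ln p / ln b * ln b) at 2 by (field; lra). nra. }
    destruct (Req_dec (- (ln p / ln b * s)) (- ln p)) as [->|]; [lra|].
    apply Rlt_le, exp_increasing. lra.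
  - intros t. rewrite Rabs_left by assumption. now apply periodic_extension_period.
  - intros x hx.
    rewrite periodic_extension_eq; [|assumption| |].
    + unfold f, Rpower. rewrite exp_ln by lra. rewrite exp_Ropp.
      field. apply Rgt_not_eq, exp_pos.
    + now apply (log_profile_shift b p q).
    + rewrite <- ln_1. destruct (Req_dec x 1) as [->|]; [lra|].
      apply Rlt_le, ln_increasing; lra.
Qed.

(** * Regular variation forces a pure power *)

Lemma filterlim_pow_at_right_0 (b : R) :
  0 < b < 1 -> filterlim (fun n => b ^ n) eventually (at_right 0).
Proof.
  intros hb. assert (h : is_lim_seq (fun n => b ^ n) 0).
  { apply is_lim_seq_geom. rewrite Rabs_pos_eq; lra. }
  intros P hP. specialize (h _ hP). unfold filtermap in *.
  apply filter_imp with (2 := h). intros n hn. apply hn, pow_lt. lra.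
Qed.

(* Along [h = b ^ n] the quotient [F (x * h) / F h] is constantly [F x]. *)
Lemma regular_variation_power (b p q a : R) (F : R -> R) :
  0 < b <= 1 / 2 -> 0 < p -> unit_interval_df F -> functional_equation b p q F ->
  (forall x, 0 < x ->
     filterlim (fun h => F (x * h) / F h) (at_right 0) (locally (Rpower x a))) ->
  forall x, 0 < x <= 1 -> F x = Rpower x a.
Proof.
  intros hb hp hF e hv x hx.
  assert (hb1 : 0 < b < 1) by lra.
  pose proof (filterlim_comp _ _ _ _ _ _ _ _ (filterlim_pow_at_right_0 b hb1)
                (hv x (proj1 hx))) as h.
  assert (h' : is_lim_seq (fun _ => F x) (Rpower x a)).
  { apply is_lim_seq_ext with (fun n => F (x * b ^ n) / F (b ^ n)); [|exact h].
    intros n.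
    rewrite (self_similar_left_pow b p q) by (assumption || lra).
    rewrite <- (Rmult_1_l (b ^ n)), (self_similar_left_pow b p q) by (assumption || lra).
    destruct hF as (_ & _ & h1). rewrite (h1 1) by lra.
    field. apply pow_nonzero. lra. }
  apply is_lim_seq_unique in h'. rewrite Lim_seq_const in h'. now injection h'.
Qed.

(* If [b < 1 / 2], then [F] takes the value [p] at both [b] and [1 - b]. If
   [b = 1 / 2], then [F (9 / 16) = F (3 / 4) ^ 2] reads
   [p + q * p ^ 3 = (p + q * p) ^ 2], that is [q ^ 2 = 2 * q ^ 3]. *)
Lemma power_self_similar_df (b p q a : R) (F : R -> R) :
  0 < b <= 1 / 2 -> 0 < p < 1 -> q = 1 - p ->
  unit_interval_df F -> functional_equation b p q F ->
  (forall x, 0 < x <= 1 -> F x = Rpower x a) ->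
  b = 1 / 2 /\ p = 1 / 2.
Proof.
  intros hb hp hq hF e hpow.
  pose proof (self_similar_above b p q F hb hF e) as above.
  pose proof (self_similar_left b p q F hb hF e) as left_.
  destruct hF as (_ & h0 & h1).
  assert (hFb : F b = p).
  { replace b with (b * 1) by ring. rewrite left_ by lra. rewrite h1; lra. }
  assert (hFb' : F (1 - b) = p).
  { rewrite above by lra. rewrite h0 by (apply right_branch_nonpos; lra). ring. }
  assert (hb2 : b = 1 / 2).
  { destruct (Req_dec b (1 / 2)) as [|hne]; [assumption|exfalso].
    rewrite hpow in hFb by lra. rewrite hpow in hFb' by lra.
    assert (hln : ln b < ln (1 - b)) by (apply ln_increasing; lra).
    assert (hexp : a * ln b = a * ln (1 - b)).
    (* The equal values at [b] and [1 - b] force exponent 0, hence [p = 1], a contradiction. *)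
    { apply exp_inv. unfold Rpower in *. congruence. }
    assert (ha : a = 0) by nra.
    rewrite ha, Rpower_O in hFb; lra. }
  split; [assumption|]. subst b.
  assert (h34 : F (3 / 4) = p + q * p).
  { rewrite above by lra. do 2 f_equal. rewrite <- hFb. f_equal. field. }
  assert (h916 : F (9 / 16) = p + q * (p * (p * p))).
  { rewrite above by lra. do 2 f_equal.
    replace (9 / 16 / (1 / 2) + 1 - 1 / (1 / 2)) with (1 / 2 * (1 / 2 * (1 / 2)))
      by field.
    rewrite !left_ by lra. now rewrite hFb. }
  assert (hsq : F (9 / 16) = F (3 / 4) * F (3 / 4)).
  { rewrite !hpow by lra. rewrite Rpower_mult_distr by lra. f_equal. lra. }
  rewrite h34, h916 in hsq. subst q.
  (* With [q = 1 - p], the two sides of [hsq] differ by [p * (1 - p) ^ 2 * (1 - 2 * p)], whose only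
     root in [(0, 1)] is [1 / 2]. *)
  assert (hz : p * ((1 - p) * (1 - p)) * (2 * p - 1) = 0) by nra.
  apply Rmult_integral in hz. destruct hz as [hz|hz]; [exfalso|lra].
  assert (0 < p * ((1 - p) * (1 - p))) by (repeat apply Rmult_lt_0_compat; lra).
  lra.
Qed.

(** * The solution, its reflection and the three properties *)

Theorem proposition2p1 (beta p q : R)
    (hbeta : 0 < beta <= 1 / 2) (hp : 0 < p < 1) (hq : q = 1 - p)
    (hne : (beta, p) <> (1 / 2, 1 / 2)) :
  exists Fp Fq : R -> R,
    unique (self_similar_df beta p q) Fp /\
    unique (self_similar_df beta q p) Fq /\
    (exists nu : R -> R,
       (forall t, 0 < nu t) /\
       (exists M, forall t, Rabs (nu t) <= M) /\
       (forall t, nu (t + Rabs (ln beta)) = nu t) /\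
       (forall x, x <= 0 -> Fp x = 0) /\
       (forall x, 0 < x <= 1 ->
          Fp x = Rpower x (ln p / ln beta) * nu (ln x)) /\
       (forall x, 1 < x -> Fp x = 1)) /\
    (forall x, 0 < x < 1 -> Fp (beta * x) = p * Fp x) /\
    (forall x, 1 - Fp (1 - x) = Fq x) /\
    ~ regularly_varying_at_1 (fun x => 1 - Fp x).
Proof.
  set (Fp := cantor_df beta p q).
  assert (hq' : 0 < q < 1) by lra.
  assert (hpq : p = 1 - q) by lra.
  assert (hFp : unit_interval_df Fp) by now apply cantor_df_unit_interval_df.
  assert (eFp : functional_equation beta p q Fp) by now apply cantor_df_equation.
  assert (cFp : forall x, continuous Fp x)
    by (intros x; now apply cantor_df_continuous).
  (* Taking the reflection itself as [Fq] makes (ii) hold by definition; what remains is that it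
     solves the exchanged equation. *)
  set (Fq := fun x => 1 - Fp (1 - x)).
  assert (hFq : unit_interval_df Fq).
  { destruct hFp as (hi & h0 & h1). unfold Fq. split; [|split].
    - now apply increasing_reflect.
    - intros x hx. rewrite h1; lra.
    - intros x hx. rewrite h0; lra. }
  assert (eFq : functional_equation beta q p Fq)
    by (apply functional_equation_reflect; try assumption; lra).
  assert (cFq : forall x, continuous Fq x).
  { intros x. apply (continuous_minus (fun _ => 1) (fun y => Fp (1 - y))).
    - apply continuous_const.
    - apply (continuous_comp (fun y => 1 - y) Fp); [|apply cFp].
      apply (ex_derive_continuous (fun y => 1 - y)). auto_derive. exact I. }
  pose proof (self_similar_df_of_continuous _ _ _ _ hFp cFp eFp) as sFp.
  pose proof (self_similar_df_of_continuous _ _ _ _ hFq cFq eFq) as sFq.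
  exists Fp, Fq. split; [|split; [|split; [|split; [|split]]]].
  - split; [assumption|]. intros G hG. now apply (self_similar_df_unique beta p q).
  - split; [assumption|]. intros G hG. now apply (self_similar_df_unique beta q p).
  - destruct (self_similar_log_periodic beta p q Fp hbeta hp hFp eFp)
      as (nu & hpos & hbound & hper & hform).
    destruct hFp as (_ & h0 & h1).
    exists nu. repeat split; try assumption. intros x hx. apply h1. lra.
  - intros x hx. apply (self_similar_left beta p q); try assumption. lra.
  - reflexivity.
  (* The quotient in [ha] is [Fq (x * h) / Fq h] by conversion, so regular variation at 1 becomes a
     statement about [Fq] at 0. *)
  - intros [a ha].
    assert (hpow : forall x, 0 < x <= 1 -> Fq x = Rpower x a)
      by (apply (regular_variation_power beta q p); try assumption; lra).
    destruct (power_self_similar_df beta q p a Fq) as [hb2 hq2]; try assumption.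
    apply hne. f_equal; lra.
Qed.
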